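(* Let $2\le k\le n$ and let $\mathcal{C}$ be a maximal (by inclusion) collection of pairwise weakly separated $k$-subsets of $[1\dots n]$. Suppose that $I\cup\{i,s\}$, $I\cup\{s,j\}$, $I\cup\{j,t\}$, $I\cup\{i,t\}\in\mathcal{C}$ for some $i<s<j<t$ in $[1\dots n]$ and some $I\subset[1\dots n]-\{i,j,s,t\}$ with $|I|=k-2$. Then $\mathcal{C}$ contains either $I\cup\{i,j\}$ or $I\cup\{s,t\}$, and not both. Moreover, the transformation $$\mathcal{C}\longmapsto\begin{cases}\big(\mathcal{C}-\{I\cup\{i,j\}\}\big)\sqcup\{I\cup\{s,t\}\} & \text{if } I\cup\{i,j\}\in\mathcal{C},\\ \big(\mathcal{C}-\{I\cup\{s,t\}\}\big)\sqcup\{I\cup\{i,j\}\} & \text{if } I\cup\{s,t\}\in\mathcal{C}\end{cases}$$ preserves weak separability and maximality; that is, the resulting collection is again a maximal collection of pairwise weakly separated $k$-subsets of $[1\dots n]$.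
   Context: Notation: $[1\dots n]=\{1,\dots,n\}$; $X-Y$ is set difference. For sets of integers write $X\prec Y$ if $x<y$ for all $x\in X$, $y\in Y$ (vacuously true if one is empty). Two $k$-subsets $I,J$ of $[1\dots n]$ are weakly separated if at least one of the following holds: (1) $J-I$ can be partitioned as $J'\sqcup J''$ with $J'\prec I-J\prec J''$; (2) $I-J$ can be partitioned as $I'\sqcup I''$ with $I'\prec J-I\prec I''$. (Parts may be empty.) *)

(* Defs.v *)
From mathcomp Require Import all_boot.

Set Implicit Arguments.
Unset Strict Implicit.
Unset Printing Implicit Defensive.

(* The ground set [1...n] is 'I_n, i.e. shifted to {0, ..., n-1}; everything
   below depends only on the order of the ground set. *)

Definition prec n (X Y : {set 'I_n}) : bool :=
  [forall x in X, forall y in Y, x < y].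

(* J - I splits as J1 \sqcup J2 (possibly empty parts) with
   J1 \prec I - J \prec J2. *)
Definition surrounds n (J I : {set 'I_n}) : bool :=
  [exists J1 : {set 'I_n}, exists J2 : {set 'I_n},
    [&& J :\: I == J1 :|: J2, [disjoint J1 & J2],
        prec J1 (I :\: J) & prec (I :\: J) J2]].

(* Only meant for sets of equal cardinality: for sets of different sizes the
   usual notion has an additional condition on the cardinalities. *)
Definition weakly_separated n (I J : {set 'I_n}) : bool :=
  surrounds J I || surrounds I J.

(* Every set is weakly separated from itself, so the pairs need not be taken
   distinct. *)
Definition ws_collection n k (C : {set {set 'I_n}}) : bool :=
  [forall A in C, #|A| == k] &&
  [forall A in C, forall B in C, weakly_separated A B].

Definition max_ws_collection n k (C : {set {set 'I_n}}) : bool :=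
  maxset (@ws_collection n k) C.

(* Main.v *)
Require Import Defs.
From mathcomp Require Import all_boot.
From mathcomp Require Import zify.

Set Implicit Arguments.
Unset Strict Implicit.
Unset Printing Implicit Defensive.

(* Weak separation of A and B fails exactly when A - B and B - A alternate
   around the circle. The heart of the proof is that a k-set J weakly separated
   from the four sides I + is, I + sj, I + jt, I + it and not from the diagonal
   I + ij is the other diagonal I + st. If J contains i or j, comparing with the
   sides forces s and t into J. Unless J meets {i, s, j, t} in {s, t}, an
   alternation with I + ij can then be moved to one of the sides. If J does meet
   it in {s, t} but J <> I + st, cardinality gives a point of J - I and a point
   of I - J off {i, s, j, t}, which alternate with the ends of some side.
   Hence each diagonal is weakly separated from every k-set compatible with the
   four sides, except the other diagonal, and the two can be exchanged. *)

(** * Cyclic order of four points *)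

Definition cyclic4 (a b c d : nat) : bool :=
  [|| [&& a < b, b < c & c < d], [&& b < c, c < d & d < a],
      [&& c < d, d < a & a < b] | [&& d < a, a < b & b < c]].

Lemma cyclic4E a b c d : cyclic4 a b c d <->
  a < b /\ b < c /\ c < d \/ b < c /\ c < d /\ d < a \/
  c < d /\ d < a /\ a < b \/ d < a /\ a < b /\ b < c.
Proof. by rewrite /cyclic4; lia. Qed.

Lemma cyclic4_rot a b c d : cyclic4 a b c d -> cyclic4 b c d a.
Proof. by rewrite !cyclic4E; lia. Qed.

(* The chord from a to c separates b from d, hence x from one of them. *)
Lemma cyclic4_insert n (a b c d x : 'I_n) : cyclic4 a b c d -> a != x -> c != x ->
  cyclic4 a b c x \/ cyclic4 a x c d.
Proof. by rewrite -!val_eqE /= !cyclic4E; lia. Qed.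

Lemma cyclic4_neq n (a b c d : 'I_n) : cyclic4 a b c d ->
  [&& a != b, a != c, a != d, b != c, b != d & c != d].
Proof. by rewrite -!val_eqE /= !cyclic4E; lia. Qed.

(** * Failure of weak separation as an alternation of points *)

Lemma surroundsPn n (A B : {set 'I_n}) :
  reflect (exists b a b', [/\ b \in B :\: A, a \in A :\: B, b' \in B :\: A
                            & b < a < b'])
          (~~ surrounds A B).
Proof.
apply: (iffP idP) => [nAB | [b [a [b' [bB aA b'B /andP[ba ab']]]]]]; last first.
  apply/existsP => -[A1 /existsP[A2 /and4P[/eqP eA _ A1B BA2]]].
  move: aA; rewrite eA inE => /orP[aA1|aA2].
    by move/forall_inP/(_ _ aA1)/forall_inP/(_ _ bB): A1B; lia.
  by move/forall_inP/(_ _ b'B)/forall_inP/(_ _ aA2): BA2; lia.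
(* The lower part is taken as large as possible. If the rest still fails to lie above [B :\: A],
   some point of the rest has points of [B :\: A] on both sides. *)
pose A1 := [set a in A :\: B | [forall b in B :\: A, a < b]].
have: ~~ prec (B :\: A) ((A :\: B) :\: A1).
  apply: contra nAB => BA2.
  apply/existsP; exists A1; apply/existsP; exists ((A :\: B) :\: A1).
  apply/and4P; split=> //.
  - by apply/eqP/setP => x; rewrite !inE; lia.
  - by rewrite -setI_eq0; apply/eqP/setP => x; rewrite !inE; lia.
  - by apply/forall_inP => a; rewrite inE => /andP[].
rewrite negb_forall_in => /exists_inP[b bB]; rewrite negb_forall_in.
move=> /exists_inP[a]; rewrite in_setD => /andP[aA1 aA]; rewrite -leqNgt => ab.
move: aA1; rewrite inE aA /= negb_forall_in => /exists_inP[b0 b0B].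
rewrite -leqNgt => b0a.
(* The negated comparisons give only [<=]; the two differences are disjoint, which makes them
   strict. *)
have neq x : x \in B :\: A -> x <> a :> nat.
  by move=> xB /val_inj xa; move: xB aA; rewrite xa !inE; lia.
exists b0, a, b; split=> //.
by have := neq _ bB; have := neq _ b0B; lia.
Qed.

(** Each of the two failing splits yields a triple, [a < b < a'] and [b1 < a1 < b2]. Comparing the
    middle points gives four alternating ones: [a < b < a1 < b2] if [b < a1], and [b1 < a1 < b < a']
    otherwise. *)
Lemma weakly_separatedPn n (A B : {set 'I_n}) :
  reflect (exists a b c d, [/\ a \in A :\: B, b \in B :\: A, c \in A :\: B,
                               d \in B :\: A & cyclic4 a b c d])
          (~~ weakly_separated A B).
Proof.
rewrite negb_or; apply: (iffP andP) => [[] | [a [b [c [d [aA bB cA dB]]]]]].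
  move=> /surroundsPn[a [b [a' [aA bB a'A lt1]]]].
  move=> /surroundsPn[b1 [a1 [b2 [b1B a1A b2B lt2]]]].
  have [ltba|ltab] := ltnP b a1.
    by exists a, b, a1, b2; split; rewrite // /cyclic4; lia.
  have neq : b <> a1 :> nat.
    by move=> /val_inj e; move: bB a1A; rewrite e !inE; lia.
  by exists a1, b, a', b1; split; rewrite // /cyclic4; lia.
(* In increasing order, the first three and the last three of the four points are the two triples
   that refute the splits. *)
rewrite /cyclic4 => /or4P[] /and3P[lt1 lt2 lt3]; split; apply/surroundsPn;
  solve [ by exists a, b, c; rewrite ?lt1 ?lt2 ?lt3
        | by exists b, c, d; rewrite ?lt1 ?lt2 ?lt3
        | by exists c, d, a; rewrite ?lt1 ?lt2 ?lt3
        | by exists d, a, b; rewrite ?lt1 ?lt2 ?lt3 ].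
Qed.

Lemma weakly_separatedC n (A B : {set 'I_n}) :
  weakly_separated A B = weakly_separated B A.
Proof. by rewrite /weakly_separated orbC. Qed.

Lemma weakly_separated_refl n (A : {set 'I_n}) : weakly_separated A A.
Proof.
by apply/negPn/weakly_separatedPn => -[a [? [? [? [+ _]]]]]; rewrite setDv inE.
Qed.

(** Shrinking both differences can only destroy alternations. *)
Lemma weakly_separated_mono n (J X Y : {set 'I_n}) :
  J :\: X \subset J :\: Y -> X :\: J \subset Y :\: J ->
  weakly_separated J Y -> weakly_separated J X.
Proof.
move=> /subsetP sJ /subsetP sX; apply: contraTT.
move=> /weakly_separatedPn[a [b [c [d [aJ bX cJ dX cyc]]]]].
apply/weakly_separatedPn; exists a, b, c, d.
by split; rewrite // ?sJ ?sX.
Qed.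

Lemma weakly_separated_cyclic4 n (J X : {set 'I_n}) (a b c d : 'I_n) :
  weakly_separated J X -> a \in J :\: X -> b \in X :\: J -> c \in J :\: X ->
  d \in X :\: J -> ~~ cyclic4 a b c d.
Proof.
move=> wJX aJ bX cJ dX; apply: contraL wJX => cyc.
by apply/weakly_separatedPn; exists a, b, c, d.
Qed.

(** * Sets enlarged by two points *)

Ltac bool_cases := do ?[case: (_ == _) => // | case: (_ \in _) => //]; by do ?split.

Lemma cardsU2 (T : finType) (A : {set T}) (x y : T) :
  x != y -> x \notin A -> y \notin A -> #|A :|: [set x; y]| = #|A| + 2.
Proof.
by move=> /negPf xy /negPf xA yA; rewrite setUCA (setUC A) !cardsU1 !inE xy xA yA addnA addnC.
Qed.

Lemma mem_setDU2 (T : finType) (A B : {set T}) (x a b : T) :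
  x \in B -> x \notin A -> x != a -> x != b -> x \in B :\: (A :|: [set a; b]).
Proof. by rewrite !inE; bool_cases. Qed.

Lemma neq_setU2 (T : finType) (A B : {set T}) (x a b : T) :
  x \in B -> x \notin A -> x != a -> x != b -> B != A :|: [set a; b].
Proof.
move=> xB xA xa xb; apply: contraTneq (mem_setDU2 xB xA xa xb) => <-.
by rewrite setDv inE.
Qed.

(** * Sets weakly separated from the four sides but not from a diagonal *)

Section Diagonal.

Context {n : nat} (I J : {set 'I_n}).
Implicit Types i s j t : 'I_n.

(** An alternation of [J] with the diagonal is one with the side [is] unless it uses [j], and with
    [sj] unless it uses [i]. If it uses both, the chord between its two points of [J] separates [i]
    from [j]; [s] lies on the side of one of them and replaces it, which gives an alternation with
    [sj] or [is]. *)
Lemma diagonal_off i s j t :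
    cyclic4 i s j t -> I \subset ~: [set i; j; s; t] ->
    i \notin J -> j \notin J -> s \notin J ->
    weakly_separated J (I :|: [set i; s]) ->
    weakly_separated J (I :|: [set s; j]) ->
  weakly_separated J (I :|: [set i; j]).
Proof.
move=> cyc /subsetP dI iJ jJ sJ w_is w_sj.
have P x : x \in J :\: (I :|: [set i; j]) ->
    [/\ x \in J :\: (I :|: [set i; s]), x \in J :\: (I :|: [set s; j])
        & x != s].
  move=> xP; have xJ : x \in J by move: xP; rewrite inE => /andP[].
  have xneq y : y \notin J -> x != y by apply: contraNneq => <-.
  by move: xP (xneq _ iJ) (xneq _ jJ) (xneq _ sJ); rewrite !inE; bool_cases.
have M x : x \in (I :|: [set i; j]) :\: J ->
    [/\ x != j -> x \in (I :|: [set i; s]) :\: J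
      & x != i -> x \in (I :|: [set s; j]) :\: J].
  by rewrite !inE; bool_cases.
have [i_is s_is s_sj j_sj] : [/\ i \in (I :|: [set i; s]) :\: J,
    s \in (I :|: [set i; s]) :\: J, s \in (I :|: [set s; j]) :\: J
    & j \in (I :|: [set s; j]) :\: J].
  have [iI sI jI] : [/\ i \notin I, s \notin I & j \notin I].
    by split; apply/negP => /dI; rewrite !inE eqxx ?orbT.
  by rewrite !inE !eqxx iJ sJ jJ !orbT.
have {}w_is := weakly_separated_cyclic4 w_is.
have {}w_sj := weakly_separated_cyclic4 w_sj.
suff main a c : a \in J :\: (I :|: [set i; j]) -> c \in J :\: (I :|: [set i; j]) ->
    ~~ cyclic4 a i c j.
  apply/negPn/weakly_separatedPn => -[a [b [c [d [aJ bJ cJ dJ cyc']]]]].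
  have [a_is a_sj _] := P a aJ; have [c_is c_sj _] := P c cJ.
  have [b_is b_sj] := M b bJ; have [d_is d_sj] := M d dJ.
  have [/andP[bj dj]|bdj] := boolP ((b != j) && (d != j)).
    by have := w_is a b c d a_is (b_is bj) c_is (d_is dj); rewrite cyc'.
  have [/andP[bi di]|bdi] := boolP ((b != i) && (d != i)).
    by have := w_sj a b c d a_sj (b_sj bi) c_sj (d_sj di); rewrite cyc'.
  move: bdj bdi; rewrite !negb_and !negbK => /orP[]/eqP e /orP[]/eqP e'.
  - by move: (cyclic4_neq cyc); rewrite -e -e' eqxx !andbF.
  - by move: (main c a cJ aJ); rewrite -e -e' => /negP[]; do 2!apply: cyclic4_rot.
  - by move: (main a c aJ cJ); rewrite -e -e' cyc'.
  - by move: (cyclic4_neq cyc); rewrite -e -e' eqxx !andbF.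
move=> aP cP; apply/negP => cyc'.
have [a_is a_sj a_s] := P a aP; have [c_is c_sj c_s] := P c cP.
have [] := cyclic4_insert cyc' a_s c_s; apply/negP.
  exact: w_is a_is i_is c_is s_is.
exact: w_sj a_sj s_sj c_sj j_sj.
Qed.

(** Dual to [diagonal_off]: an alternation passes to the side [sj] or [jt] unless its two points of
    [J] are [s] and [t]. The chord between the other two then separates [s] from [t], and [i]
    replaces the one on whose side it lies. *)
Lemma diagonal_on i s j t :
    cyclic4 i s j t -> I \subset ~: [set i; j; s; t] ->
    i \in J -> s \in J -> t \in J ->
    weakly_separated J (I :|: [set s; j]) ->
    weakly_separated J (I :|: [set j; t]) ->
  weakly_separated J (I :|: [set i; j]).
Proof.
move=> cyc /subsetP dI iJ sJ tJ w_sj w_jt.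
have P x : x \in J :\: (I :|: [set i; j]) ->
    [/\ x != s -> x \in J :\: (I :|: [set s; j])
      & x != t -> x \in J :\: (I :|: [set j; t])].
  by rewrite !inE; bool_cases.
have M x : x \in (I :|: [set i; j]) :\: J ->
    [/\ x \in (I :|: [set s; j]) :\: J, x \in (I :|: [set j; t]) :\: J
        & x != i].
  move=> xM; have xJ : x \notin J by move: xM; rewrite inE => /andP[].
  have xneq y : y \in J -> x != y by apply: contraTneq => <-.
  by move: xM (xneq _ iJ) (xneq _ sJ) (xneq _ tJ); rewrite !inE; bool_cases.
have notI x : x \in I -> [/\ x != i, x != s & x != t].
  by move=> /dI; rewrite !inE; bool_cases.
have [i_sj t_sj i_jt s_jt] : [/\ i \in J :\: (I :|: [set s; j]),
    t \in J :\: (I :|: [set s; j]), i \in J :\: (I :|: [set j; t])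
    & s \in J :\: (I :|: [set j; t])].
  have [iI sI tI] : [/\ i \notin I, s \notin I & t \notin I].
    by split; apply/negP => /notI; rewrite eqxx; case.
  move: (cyclic4_neq cyc) iI sI tI iJ sJ tJ; rewrite !inE !(eq_sym t).
  by bool_cases.
have {}w_sj := weakly_separated_cyclic4 w_sj.
have {}w_jt := weakly_separated_cyclic4 w_jt.
have main b d : b \in (I :|: [set i; j]) :\: J -> d \in (I :|: [set i; j]) :\: J ->
    ~~ cyclic4 s b t d.
  move=> /M[b_sj b_jt b_i] /M[d_sj d_jt d_i]; apply/negP => /cyclic4_rot cyc'.
  have [/cyclic4_rot|] := cyclic4_insert cyc' b_i d_i; apply/negP.
    exact: w_sj t_sj d_sj i_sj b_sj.
  apply: contra (w_jt i d s b i_jt d_jt s_jt b_jt).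
  exact: cyclic4_rot.
apply/negPn/weakly_separatedPn => -[a [b [c [d [aJ bJ cJ dJ cyc']]]]].
have [a_sj a_jt] := P a aJ; have [c_sj c_jt] := P c cJ.
have [b_sj b_jt _] := M b bJ; have [d_sj d_jt _] := M d dJ.
have [/andP[ans cns]|acs] := boolP ((a != s) && (c != s)).
  by have := w_sj a b c d (a_sj ans) b_sj (c_sj cns) d_sj; rewrite cyc'.
have [/andP[ant cnt]|act] := boolP ((a != t) && (c != t)).
  by have := w_jt a b c d (a_jt ant) b_jt (c_jt cnt) d_jt; rewrite cyc'.
move: acs act; rewrite !negb_and !negbK => /orP[]/eqP e /orP[]/eqP e'.
- by move: (cyclic4_neq cyc); rewrite -e -e' eqxx !andbF.
- by move: (main b d bJ dJ); rewrite -e -e' cyc'.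
- by move: (main d b dJ bJ); rewrite -e -e' => /negP[]; do 2!apply: cyclic4_rot.
- by move: (cyclic4_neq cyc); rewrite -e -e' eqxx !andbF.
Qed.

Lemma diagonal_opposite i s j t :
    cyclic4 i s j t -> I \subset ~: [set i; j; s; t] -> #|J| = #|I| + 2 ->
    i \notin J -> j \notin J -> s \in J -> t \in J ->
    weakly_separated J (I :|: [set i; s]) ->
    weakly_separated J (I :|: [set s; j]) ->
    weakly_separated J (I :|: [set j; t]) ->
    weakly_separated J (I :|: [set i; t]) ->
  J = I :|: [set s; t].
Proof.
move=> cyc /subsetP dI cardJ iJ jJ sJ tJ w_is w_sj w_jt w_it.
have notI x : x \in I -> [/\ x != i, x != s, x != j & x != t].
  by move=> /dI; rewrite !inE; bool_cases.
have [sI tI] : s \notin I /\ t \notin I.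
  by split; apply/negP => /notI; rewrite eqxx; case.
have neq := cyclic4_neq cyc.
have cardK : #|I :|: [set s; t]| = #|I| + 2.
  by apply: cardsU2 sI tI; case/and5P: neq => _ _ _ _ /andP[].
apply/eqP; rewrite eqEcard cardK cardJ leqnn andbT.
apply/negPn/subsetPn => -[p pJ pK].
have /subsetPn[q qK qJ] : ~~ (I :|: [set s; t] \subset J).
  apply: contra pK => sKJ.
  by have /eqP-> : I :|: [set s; t] == J by rewrite eqEcard sKJ cardK cardJ /=.
have [p_i p_j] : i != p /\ j != p by split; apply: contraTneq pJ => <-.
have {pK}[pI s_p t_p] : [/\ p \notin I, s != p & t != p].
  by move: pK; rewrite !inE !(eq_sym p); bool_cases.
have [s_q t_q] : s != q /\ t != q by split; apply: contraNneq qJ => <-.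
have {}qK : q \in I by move: qK s_q t_q; rewrite !inE !(eq_sym q); bool_cases.
have p_q : p != q by apply: contraNneq pI => ->.
have qM y z : q \in (I :|: [set y; z]) :\: J by rewrite !inE qK qJ.
have M y z : y \notin J ->
    y \in (I :|: [set y; z]) :\: J /\ y \in (I :|: [set z; y]) :\: J.
  by move=> yJ; rewrite !inE eqxx !orbT yJ.
have [[i_s j_s t_s] [s_t i_t j_t]] :
    [/\ i != s, j != s & t != s] /\ [/\ s != t, i != t & j != t].
  by move: neq; rewrite (eq_sym t s) (eq_sym j s); bool_cases.
have P x y z : x \in J -> x \notin I -> y != x -> z != x ->
    x \in J :\: (I :|: [set y; z]).
  by rewrite (eq_sym y) (eq_sym z); apply: mem_setDU2.
have {}w_is := weakly_separated_cyclic4 w_is.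
have {}w_sj := weakly_separated_cyclic4 w_sj.
have {}w_jt := weakly_separated_cyclic4 w_jt.
have {}w_it := weakly_separated_cyclic4 w_it.
(* The chord from [i] to [j] puts [p] opposite [s] or opposite [t]. The chord from [p] to that point
   separates [i] from [j], so [q] alternates with one of these two across it. The side violated
   joins that one to whichever of [s], [t] is not on the chord. *)
have [] := cyclic4_insert cyc p_i p_j.
  do 3!move/cyclic4_rot; move=> /cyclic4_insert-/(_ q p_q s_q)[]; apply/negP.
  - by apply: w_it (P _ _ _ _ _ _ _) (M _ _ _).1 (P _ _ _ _ _ _ _) (qM _ _).
  - by apply: w_jt (P _ _ _ _ _ _ _) (qM _ _) (P _ _ _ _ _ _ _) (M _ _ _).1.
move=> /cyclic4_rot/cyclic4_insert-/(_ q p_q t_q)[]; apply/negP.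
- by apply: w_sj (P _ _ _ _ _ _ _) (M _ _ _).2 (P _ _ _ _ _ _ _) (qM _ _).
- by apply: w_is (P _ _ _ _ _ _ _) (qM _ _) (P _ _ _ _ _ _ _) (M _ _ _).1.
Qed.

(** Trading a point [y] outside [J] for a point [x] of [J] shrinks both differences. This carries
    separation from a side over to a diagonal. *)
Lemma weakly_separated_exchange x y z :
    x \in J -> y \notin J -> weakly_separated J (I :|: [set z; y]) ->
  weakly_separated J (I :|: [set z; x]).
Proof.
move=> xJ yJ; apply: weakly_separated_mono; apply/subsetP => u; rewrite !inE.
  have [->|] := eqVneq u y; first by rewrite (negPf yJ) andbF.
  by lia.
have [->|] := eqVneq u x; first by rewrite xJ.
by lia.
Qed.

Lemma not_weakly_separated_diagonal i s j t :
    cyclic4 i s j t -> I \subset ~: [set i; j; s; t] -> #|J| = #|I| + 2 ->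
    weakly_separated J (I :|: [set i; s]) ->
    weakly_separated J (I :|: [set s; j]) ->
    weakly_separated J (I :|: [set j; t]) ->
    weakly_separated J (I :|: [set i; t]) ->
    ~~ weakly_separated J (I :|: [set i; j]) ->
  J = I :|: [set s; t].
Proof.
move=> cyc dI cardJ w_is w_sj w_jt w_it nw.
(* A half turn swaps [i] with [j] and [s] with [t], so the lemmas above also cover the mirror
   cases. *)
have cyc' : cyclic4 j t i s by do 2!apply: cyclic4_rot.
have dI' : I \subset ~: [set j; i; t; s].
  by apply: subset_trans dI _; apply/subsetP => x; rewrite !inE; bool_cases.
have [w_si w_js w_tj w_ti] : [/\ weakly_separated J (I :|: [set s; i]),
    weakly_separated J (I :|: [set j; s]), weakly_separated J (I :|: [set t; j])
    & weakly_separated J (I :|: [set t; i])].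
  by split; rewrite [X in I :|: X]setUC.
have nw' : ~~ weakly_separated J (I :|: [set j; i]).
  by rewrite [X in I :|: X]setUC.
(* If [s] or [t] were missing from [J], trading it for [j] in a side would make [J] weakly separated
   from the diagonal. *)
have jst : j \in J -> s \in J /\ t \in J.
  by move=> jJ; split; apply: contraNT nw => nJ;
    [exact: weakly_separated_exchange jJ nJ w_is | exact: weakly_separated_exchange jJ nJ w_it].
have ist : i \in J -> s \in J /\ t \in J.
  by move=> iJ; split; apply: contraNT nw' => nJ;
    [exact: weakly_separated_exchange iJ nJ w_js | exact: weakly_separated_exchange iJ nJ w_jt].
have [iJ|iJ] := boolP (i \in J).
  have [sJ tJ] := ist iJ.
  by rewrite (diagonal_on cyc dI iJ sJ tJ w_sj w_jt) in nw.
have [jJ|jJ] := boolP (j \in J).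
  have [sJ tJ] := jst jJ.
  by rewrite (diagonal_on cyc' dI' jJ tJ sJ w_ti w_is) in nw'.
have [sJ|sJ] := boolP (s \in J); last first.
  by rewrite (diagonal_off cyc dI iJ jJ sJ w_is w_sj) in nw.
have [tJ|tJ] := boolP (t \in J); last first.
  by rewrite (diagonal_off cyc' dI' jJ iJ tJ w_jt w_ti) in nw'.
exact: (diagonal_opposite cyc dI).
Qed.

End Diagonal.

(** * Exchanging one member of a maximal collection *)

Section Exchange.

Context {n k : nat} (C : {set {set 'I_n}}).

Lemma ws_collectionP (D : {set {set 'I_n}}) :
  reflect ({in D, forall A : {set _}, #|A| = k} /\ {in D &, forall A B, weakly_separated A B})
          (ws_collection k D).
Proof.
apply: (iffP andP) => -[cD wD]; split.
- by move=> A /(forall_inP cD)/eqP.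
- by move=> A B AD /(forall_inP (forall_inP wD A AD)).
- by apply/forall_inP => A /cD ->.
- by apply/forall_inP => A AD; apply/forall_inP => B; apply: wD.
Qed.

Lemma ws_collection_add (D : {set {set 'I_n}}) (A : {set 'I_n}) :
    ws_collection k D -> #|A| = k -> {in D, forall B, weakly_separated B A} ->
  ws_collection k (A |: D).
Proof.
move=> /ws_collectionP[cD wD] cA wA; apply/ws_collectionP; split=> [B | B E].
  by case/setU1P=> [-> | /cD].
case/setU1P=> [-> | BD] /setU1P[-> | ED]; [ | | exact: wA | exact: wD].
  exact: weakly_separated_refl.
by rewrite weakly_separatedC wA.
Qed.

Lemma max_ws_collection_mem (A : {set 'I_n}) :
    max_ws_collection k C -> #|A| = k -> {in C, forall B, weakly_separated B A} ->
  A \in C.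
Proof.
case/maxsetP=> wC maxC cA /(ws_collection_add wC cA)/maxC <-; first exact: setU11.
exact: subsetUr.
Qed.

(** [S] stands for the sides, [A] and [B] for the diagonals. Every member of [C] other than [A] is
    compatible with [S], hence with [B], so the new collection is weakly separated. Its maximality
    is inherited from that of [C]. *)
Lemma max_ws_collection_exchange (S : {set {set 'I_n}}) (A B : {set 'I_n}) :
    max_ws_collection k C -> S \subset C -> A \in C -> A \notin S ->
    #|B| = k -> ~~ weakly_separated A B ->
    (forall J : {set 'I_n}, #|J| = k -> {in S, forall X, weakly_separated J X} ->
      ~~ weakly_separated J A -> J = B) ->
    (forall J : {set 'I_n}, #|J| = k -> {in S, forall X, weakly_separated J X} ->
      ~~ weakly_separated J B -> J = A) ->
  max_ws_collection k (B |: C :\ A).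
Proof.
move=> maxC /subsetP SC AC AS cB nAB nA nB.
have /maxsetP[/ws_collectionP[cC wC] _] := maxC.
(* As [A] is not in [S], all of [S] survives the removal of [A] and so lies in any larger collection
   [D]. *)
have SCA X : X \in S -> X \in C :\ A.
  by move=> XS; rewrite !inE SC // andbT; apply: contraNneq AS => <-.
apply/maxsetP; split=> [|D /ws_collectionP[cD wD] sD].
  apply: ws_collection_add => // [|X /setD1P[XA XC]].
    apply/ws_collectionP; split=> [X | X Y] /setD1P[_ XC]; first exact: cC.
    by case/setD1P=> _; apply: wC.
  apply: contraNT XA => /nB->; rewrite ?cC // => Y /SC YC; exact: wC.
have sCD := subset_trans (subsetUr _ _) sD.
apply/eqP; rewrite eqEsubset sD andbT; apply/subsetP => J JD.
have wJ : {in S, forall X, weakly_separated J X}.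
  by move=> X /SCA /(subsetP sCD); apply: wD.
have BD : B \in D by rewrite (subsetP sD) // setU11.
(* A member [J] of [D] other than [B] is compatible with [A] as well, hence with all of [C], and
   maximality of [C] puts it in [C]. *)
have [->|JB] := eqVneq J B; first exact: setU11.
have JA : J != A by apply: contraNneq nAB => <-; apply: wD.
rewrite !inE JA /= (max_ws_collection_mem maxC) ?orbT ?cD // => X XC.
have [->|XA] := eqVneq X A.
  by rewrite weakly_separatedC; apply: contraNT JB => /nA->; rewrite ?cD.
by apply: wD => //; rewrite (subsetP sCD) // !inE XA.
Qed.

End Exchange.

(** * Exchange of the two diagonals *)

Theorem theorem3 (n k : nat) (hk : 2 <= k) (hkn : k <= n)
    (C : {set {set 'I_n}}) (hC : max_ws_collection k C)
    (I : {set 'I_n}) (i s j t : 'I_n)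
    (his : i < s) (hsj : s < j) (hjt : j < t)
    (hI : I \subset ~: [set i; j; s; t]) (hIk : #|I| = k - 2)
    (h_is : I :|: [set i; s] \in C) (h_sj : I :|: [set s; j] \in C)
    (h_jt : I :|: [set j; t] \in C) (h_it : I :|: [set i; t] \in C) :
  [/\ I :|: [set i; j] \in C \/ I :|: [set s; t] \in C,
      ~ (I :|: [set i; j] \in C /\ I :|: [set s; t] \in C),
      I :|: [set i; j] \in C ->
        max_ws_collection k
          ((I :|: [set s; t]) |: (C :\ (I :|: [set i; j])))
    & I :|: [set s; t] \in C ->
        max_ws_collection k
          ((I :|: [set i; j]) |: (C :\ (I :|: [set s; t])))].
Proof.
have cyc : cyclic4 i s j t by rewrite cyclic4E; lia.
(* A quarter turn swaps the two diagonals, so one lemma serves both. *)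
have cyc' : cyclic4 s j t i by apply: cyclic4_rot.
have hI' : I \subset ~: [set s; t; j; i].
  by apply: subset_trans hI _; apply/subsetP => x; rewrite !inE; bool_cases.
have off x : x \in I -> [/\ x != i, x != s, x != j & x != t].
  by move=> /(subsetP hI); rewrite !inE; bool_cases.
have [iI sI jI tI] : [/\ i \notin I, s \notin I, j \notin I & t \notin I].
  by split; apply/negP => /off; rewrite eqxx; case.
have cardI : #|I| + 2 = k by rewrite hIk subnK.
have /and5P[i_s i_j i_t s_j /andP[s_t j_t]] := cyclic4_neq cyc.
have [s_i [j_i j_s] [t_i t_s t_j]] :
    [/\ s != i, j != i /\ j != s & [/\ t != i, t != s & t != j]].
  by do !split; rewrite eq_sym.
have c_ij : #|I :|: [set i; j]| = k by rewrite cardsU2.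
have c_st : #|I :|: [set s; t]| = k by rewrite cardsU2.
pose S := [set I :|: [set i; s]; I :|: [set s; j]; I :|: [set j; t]; I :|: [set i; t]].
have SC : S \subset C by rewrite !subUset !sub1set h_is h_sj h_jt h_it.
have wS (J : {set 'I_n}) : {in S, forall X, weakly_separated J X} ->
    [/\ weakly_separated J (I :|: [set i; s]), weakly_separated J (I :|: [set s; j]),
        weakly_separated J (I :|: [set j; t]) & weakly_separated J (I :|: [set i; t])].
  by move=> wJ; split; apply: wJ; rewrite !inE eqxx ?orbT.
have n_ij (J : {set 'I_n}) : #|J| = k -> {in S, forall X, weakly_separated J X} ->
    ~~ weakly_separated J (I :|: [set i; j]) -> J = I :|: [set s; t].
  rewrite -cardI => cJ /wS[w_is w_sj w_jt w_it].
  exact: not_weakly_separated_diagonal cyc hI cJ w_is w_sj w_jt w_it.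
have n_st (J : {set 'I_n}) : #|J| = k -> {in S, forall X, weakly_separated J X} ->
    ~~ weakly_separated J (I :|: [set s; t]) -> J = I :|: [set i; j].
  rewrite -cardI (setUC [set i] [set j]) => cJ /wS[w_is w_sj w_jt w_it].
  have [w_si w_ti] : weakly_separated J (I :|: [set s; i]) /\
      weakly_separated J (I :|: [set t; i]).
    by rewrite (setUC [set s]) (setUC [set t]).
  exact: not_weakly_separated_diagonal cyc' hI' cJ w_sj w_jt w_ti w_si.
have nw : ~~ weakly_separated (I :|: [set i; j]) (I :|: [set s; t]).
  (* The four corners themselves alternate. *)
  apply/weakly_separatedPn; exists i, s, j, t.
  by split; rewrite // mem_setDU2 // !inE eqxx ?orbT.
have ijS : I :|: [set i; j] \notin S.
  (* Each side misses an end of the diagonal; that end is the witness. *)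
  rewrite !inE !negb_or -!andbA.
  by apply/and4P; split; [apply: (@neq_setU2 _ _ _ j) | apply: (@neq_setU2 _ _ _ i) |
    apply: (@neq_setU2 _ _ _ i) | apply: (@neq_setU2 _ _ _ j)];
    rewrite // !inE eqxx ?orbT.
have stS : I :|: [set s; t] \notin S.
  rewrite !inE !negb_or -!andbA.
  by apply/and4P; split; [apply: (@neq_setU2 _ _ _ t) | apply: (@neq_setU2 _ _ _ t) |
    apply: (@neq_setU2 _ _ _ s) | apply: (@neq_setU2 _ _ _ s)];
    rewrite // !inE eqxx ?orbT.
have /maxsetP[/ws_collectionP[cC wC] _] := hC.
split.
(* Either [I :|: [set i; j]] is compatible with all of [C] and belongs to it by maximality, or a
   member incompatible with it must be the other diagonal. *)
- have [/forall_inP w|] := boolP [forall B in C, weakly_separated B (I :|: [set i; j])].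
    by left; exact: max_ws_collection_mem hC c_ij w.
  rewrite negb_forall_in => /exists_inP[J JC /n_ij JE]; right; rewrite -JE ?cC //.
  by move=> X /(subsetP SC); apply: wC.
- by case=> ijC stC; rewrite wC in nw.
- move=> ijC; exact: max_ws_collection_exchange hC SC ijC ijS c_st nw n_ij n_st.
- move=> stC; apply: max_ws_collection_exchange hC SC stC stS c_ij _ n_st n_ij.
  by rewrite weakly_separatedC.
Qed.
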